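(* The adaptive projected gradient descent (APGD) algorithm for randomized ensembles of classifiers is inconsistent. Explicitly: for every $p\in[1,\infty]$, every step size $\eta>0$ and every number of iterations $K\ge 1$, there exist a randomized ensemble classifier $(\mathcal F,\boldsymbol\alpha)$, a labeled data-point $(\mathbf x,y)$, a norm bound $\epsilon>0$, and an admissible initial guess $\boldsymbol\delta^{(0)}$ with $\|\boldsymbol\delta^{(0)}\|_p\le\epsilon$, such that (i) $L(\mathbf x,y,\boldsymbol\alpha)=1$; (ii) there exists $\boldsymbol\delta$ with $\|\boldsymbol\delta\|_p\le\epsilon$ and $L(\mathbf x+\boldsymbol\delta,y,\boldsymbol\alpha)<L(\mathbf x,y,\boldsymbol\alpha)$; (iii) the output $\boldsymbol\delta^{(K)}$ of APGD started at $\boldsymbol\delta^{(0)}$ is not adversarial, i.e. $L(\mathbf x+\boldsymbol\delta^{(K)},y,\boldsymbol\alpha)\ge L(\mathbf x,y,\boldsymbol\alpha)$.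
   Context: **Classifiers.** A ($C$-ary, differentiable) classifier is a differentiable map $f:\mathbb R^D\to\mathbb R^C$; it assigns label $m\in\{1,\dots,C\}$ to $\mathbf x$ iff $[f(\mathbf x)]_m>[f(\mathbf x)]_j$ for all $j\ne m$. In the binary case one may equivalently use a scalar differentiable $f:\mathbb R^D\to\mathbb R$ with labels $y\in\{-1,1\}$, where $f$ assigns label $1$ to $\mathbf x$ iff $f(\mathbf x)>0$, and label $-1$ otherwise. In particular, binary linear classifiers $f(\mathbf x)=\mathbf w^{T}\mathbf x+b$, with $\mathbf w\in\mathbb R^D$ and $b\in\mathbb R$, are allowed. **Randomized ensemble classifier (REC).** An REC $(\mathcal F,\boldsymbol\alpha)$ consists of finitely many classifiers $\mathcal F=\{f_1,\dots,f_M\}$ (all with the same input space and label set) and probabilities $\boldsymbol\alpha=(\alpha_1,\dots,\alpha_M)$ with $\alpha_i>0$ and $\sum_i\alpha_i=1$; classifier $f_i$ is used with probability $\alpha_i$, independently of the input. Its expected accuracy at $(\mathbf x,y)$ is $$L(\mathbf x,y,\boldsymbol\alpha)=\sum_{i=1}^M\alpha_i\,\mathbb 1\{f_i\text{ assigns label }y\text{ to }\mathbf x\}.$$ **Adversarial perturbations and consistency.** A perturbation $\boldsymbol\delta\in\mathbb R^D$ is adversarial to $(\mathcal F,\boldsymbol\alpha)$ for $(\mathbf x,y)$ if $L(\mathbf x+\boldsymbol\delta,y,\boldsymbol\alpha)<L(\mathbf x,y,\boldsymbol\alpha)$. An algorithm that takes an REC, a labeled data-point and a norm bound $\epsilon$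 and outputs a perturbation of $\ell_p$ norm at most $\epsilon$ is consistent if its output is adversarial whenever $L(\mathbf x,y,\boldsymbol\alpha)=1$ and some adversarial $\boldsymbol\delta$ with $\|\boldsymbol\delta\|_p\le\epsilon$ exists; otherwise it is inconsistent. **APGD.** Let $l$ be the cross-entropy loss: $l(f(\mathbf x),y)=-\log\big(e^{[f(\mathbf x)]_y}/\sum_j e^{[f(\mathbf x)]_j}\big)$ for $C$-ary classifiers, and for scalar binary classifiers $$l(f(\mathbf x),y)=-\tfrac{1+y}{2}\log\frac{e^{f(\mathbf x)}}{1+e^{f(\mathbf x)}}-\tfrac{1-y}{2}\log\frac{1}{1+e^{f(\mathbf x)}}.$$ Starting from an initial guess $\boldsymbol\delta^{(0)}$ (chosen randomly, anywhere in the $\ell_p$ ball $\|\boldsymbol\delta^{(0)}\|_p\le\epsilon$), APGD performs, for $k=1,\dots,K$, $$\boldsymbol\delta^{(k)}=\Pi_\epsilon^p\Big(\boldsymbol\delta^{(k-1)}+\eta\,\mu_p\Big(\sum_{i=1}^M\alpha_i\nabla_{\mathbf x}\,l\big(f_i(\mathbf x+\boldsymbol\delta^{(k-1)}),y\big)\Big)\Big)$$ and outputs $\boldsymbol\delta^{(K)}$. Here $\Pi_\epsilon^p$ is projection onto the closed $\ell_p$ ball of radius $\epsilon$ centered at $\mathbf 0$ (it fixes every point of the ball), and $\mu_p(\mathbf u)$ is the unit-$\ell_p$-norm steepest ascent direction for $\mathbf u\neq \mathbf 0$ (for example $\mu_\infty=\mathrm{sgn}$ entrywise), with $\mu_p(\mathbf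 0)=\mathbf 0$. *)

(* Defs.v *)
From HB Require Import structures.
From mathcomp Require Import all_boot all_order all_algebra.
From mathcomp Require Import all_classical all_reals all_analysis.

Set Implicit Arguments.
Unset Strict Implicit.
Unset Printing Implicit Defensive.

Import Order.TTheory GRing.Theory Num.Theory.
Import numFieldNormedType.Exports.

Local Open Scope classical_set_scope.
Local Open Scope ring_scope.

(* Only meaningful for 1 <= p; the library norm `|v| on row vectors is the
   maximum of the absolute values of the entries. *)
Definition lpnorm (R : realType) (D : nat) (p : \bar R) (v : 'rV[R]_D) : R :=
  match p with
  | r%:E => (\sum_(j < D) `|v 0 j| `^ r) `^ r^-1
  | +oo%E => `|v|
  | -oo%E => 0
  end.

Definition dotp (R : realType) (D : nat) (u v : 'rV[R]_D) : R :=
  \sum_(j < D) u 0 j * v 0 j.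

Definition grad (R : realType) (D : nat) (g : 'rV[R]_D -> R) (x : 'rV[R]_D) :
    'rV[R]_D :=
  \row_j 'D_(delta_mx 0 j) g x.

(* For p = 1 and p = +oo the maximizer need not be unique (the entrywise sign
   is one for p = +oo), so [mu] is any selection of maximizers. *)
Definition is_steepest_ascent (R : realType) (p : \bar R)
    (mu : forall D : nat, 'rV[R]_D -> 'rV[R]_D) : Prop :=
  forall D : nat,
    mu D 0 = 0 /\
    forall u : 'rV[R]_D, u != 0 ->
      lpnorm p (mu D u) = 1 /\
      forall v : 'rV[R]_D, lpnorm p v = 1 -> dotp u v <= dotp u (mu D u).

(* [Pi D eps] maps each point to a point of the l_p ball of radius [eps] that is
   nearest to it in l_q norm: q = 2 is the Euclidean projection, while q = p
   covers, for instance, radial rescaling onto the ball. *)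
Definition is_ball_projection (R : realType) (p q : \bar R)
    (Pi : forall D : nat, R -> 'rV[R]_D -> 'rV[R]_D) : Prop :=
  forall (D : nat) (eps : R), 0 < eps -> forall u : 'rV[R]_D,
    lpnorm p (Pi D eps u) <= eps /\
    forall v : 'rV[R]_D, lpnorm p v <= eps ->
      lpnorm q (u - Pi D eps u) <= lpnorm q (u - v).

(* [Scalar]: a binary classifier with one real score; [Vector C]: a C-ary
   classifier with a score vector in R^C. *)
Variant format := Scalar | Vector of nat.

(* A binary label is [true] for y = 1 and [false] for y = -1. *)
Definition label (k : format) : finType :=
  match k with
  | Scalar => bool
  | Vector C => 'I_C
  end.

Definition score (R : realType) (k : format) : normedModType R :=
  match k with
  | Scalar => R^o
  | Vector C => 'rV[R]_C
  end.

Definition assigns (R : realType) (k : format) : score R k -> label k -> bool :=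
  match k return score R k -> label k -> bool with
  | Scalar => fun (s : R) (y : bool) => if y then 0 < s else ~~ (0 < s)
  | Vector C => fun (s : 'rV[R]_C) (y : 'I_C) =>
      [forall j : 'I_C, (j != y) ==> (s 0 j < s 0 y)]
  end.

Definition ysign (R : realType) (y : bool) : R := if y then 1 else -1.

Definition cross_entropy (R : realType) (k : format) :
    score R k -> label k -> R :=
  match k return score R k -> label k -> R with
  | Scalar => fun (s : R) (y : bool) =>
      - ((1 + ysign R y) / 2) * ln (expR s / (1 + expR s))
      - ((1 - ysign R y) / 2) * ln (1 / (1 + expR s))
  | Vector C => fun (s : 'rV[R]_C) (y : 'I_C) =>
      - ln (expR (s 0 y) / \sum_(j < C) expR (s 0 j))
  end.

Record REC (R : realType) := MkREC {
  rec_dim : nat;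
  rec_format : format;
  rec_size : nat;
  rec_clf : 'I_rec_size -> 'rV[R]_rec_dim -> score R rec_format;
  rec_prob : 'I_rec_size -> R;
  rec_clf_diff : forall i x, differentiable (rec_clf i) x;
  rec_prob_gt0 : forall i, 0 < rec_prob i;
  rec_prob_sum1 : \sum_i rec_prob i = 1
}.

Definition accuracy (R : realType) (E : REC R)
    (x : 'rV[R]_(rec_dim E)) (y : label (rec_format E)) : R :=
  \sum_i rec_prob i * (assigns (rec_clf i x) y)%:R.

Definition adversarial (R : realType) (E : REC R)
    (x : 'rV[R]_(rec_dim E)) (y : label (rec_format E))
    (delta : 'rV[R]_(rec_dim E)) : Prop :=
  accuracy (x + delta) y < accuracy x y.

(* An algorithm is given by the set of its possible outputs, over all of its
   internal random choices, on an ensemble, a data-point and a norm bound. *)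
Definition algorithm (R : realType) : Type :=
  forall E : REC R,
    'rV[R]_(rec_dim E) -> label (rec_format E) -> R -> set 'rV[R]_(rec_dim E).

Definition consistent (R : realType) (p : \bar R) (A : algorithm R) : Prop :=
  forall (E : REC R) (x : 'rV[R]_(rec_dim E)) (y : label (rec_format E))
      (eps : R),
    0 < eps ->
    accuracy x y = 1 ->
    (exists2 delta, lpnorm p delta <= eps & adversarial x y delta) ->
    forall delta, A E x y eps delta -> adversarial x y delta.

Definition apgd_step (R : realType)
    (mu : forall D : nat, 'rV[R]_D -> 'rV[R]_D)
    (Pi : forall D : nat, R -> 'rV[R]_D -> 'rV[R]_D) (eta : R) (E : REC R)
    (x : 'rV[R]_(rec_dim E)) (y : label (rec_format E)) (eps : R)
    (delta : 'rV[R]_(rec_dim E)) : 'rV[R]_(rec_dim E) :=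
  let g := \sum_i rec_prob i *:
    grad (fun z => cross_entropy (rec_clf i (z + delta)) y) x in
  Pi _ eps (delta + eta *: mu _ g).

Definition apgd (R : realType)
    (mu : forall D : nat, 'rV[R]_D -> 'rV[R]_D)
    (Pi : forall D : nat, R -> 'rV[R]_D -> 'rV[R]_D) (eta : R) (K : nat)
    (E : REC R) (x : 'rV[R]_(rec_dim E)) (y : label (rec_format E)) (eps : R)
    (delta0 : 'rV[R]_(rec_dim E)) : 'rV[R]_(rec_dim E) :=
  iter K (apgd_step mu Pi eta x y eps) delta0.

Definition APGD (R : realType) (p : \bar R)
    (mu : forall D : nat, 'rV[R]_D -> 'rV[R]_D)
    (Pi : forall D : nat, R -> 'rV[R]_D -> 'rV[R]_D) (eta : R) (K : nat) :
    algorithm R :=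
  fun E x y eps =>
    [set apgd mu Pi eta K x y eps delta0
      | delta0 in [set d : 'rV[R]_(rec_dim E) | lpnorm p d <= eps]].

(* Main.v *)
Require Import Defs.
From HB Require Import structures.
From mathcomp Require Import all_boot all_order all_algebra.
From mathcomp Require Import all_classical all_reals all_analysis.

(** Take the two linear classifiers [1 + z] and [1 - z] on the real line, each
    with probability 1/2, and the point 0 with label 1.  At 0 the two loss
    gradients are opposite, so APGD started at 0 never moves, although the
    perturbation 2 fools the second classifier. *)

Import Order.TTheory GRing.Theory Num.Theory.
Import numFieldNormedType.Exports.

Local Open Scope classical_set_scope.
Local Open Scope ring_scope.

Lemma lpnorm0 (R : realType) (p : \bar R) (D : nat) :
  (1 <= p)%E -> lpnorm p (0 : 'rV[R]_D) = 0.
Proof.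
case: p => [r||] //=; last by rewrite normr0.
rewrite lee_fin => r1; have r0 : r != 0 by rewrite gt_eqF// (lt_le_trans ltr01).
rewrite big1 => [|j _]; first by rewrite powR0 ?invr_eq0.
by rewrite mxE normr0 powR0.
Qed.

(** Definiteness of the norm; applied to the exponent [q] that measures distance in the
    projection. *)
Lemma lpnorm_le0_eq0 (R : realType) (p : \bar R) (D : nat) (u : 'rV[R]_D) :
  (1 <= p)%E -> lpnorm p u <= 0 -> u = 0.
Proof.
case: p => [r||] //=; last by move=> _; rewrite normr_le0 => /eqP.
rewrite lee_fin => r1; have r0 : r != 0 by rewrite gt_eqF// (lt_le_trans ltr01).
move=> h; have /eqP : (\sum_(j < D) `|u 0 j| `^ r) `^ r^-1 = 0.
  by apply/eqP; rewrite eq_le h powR_ge0.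
rewrite powR_eq0 => /andP[+ _]; rewrite psumr_eq0 => [|j _]; last exact: powR_ge0.
move=> /allP h0; apply/rowP => j; rewrite mxE.
by have := h0 j (mem_index_enum j); rewrite /= powR_eq0 normr_eq0 => /andP[/eqP].
Qed.

(** The origin lies in the ball, so a nearest point to it is at distance at most 0 from it, hence
    equal to it. *)
Lemma ball_projection0 (R : realType) (p q : \bar R)
    (Pi : forall D : nat, R -> 'rV[R]_D -> 'rV[R]_D) (D : nat) (eps : R) :
  (1 <= p)%E -> (1 <= q)%E -> is_ball_projection p q Pi -> 0 < eps ->
  Pi D eps 0 = 0.
Proof.
move=> p1 q1 hPi e0; have [_ /(_ 0)] := hPi D eps e0 0.
rewrite lpnorm0 // (ltW e0) subr0 lpnorm0 // sub0r => /(_ isT).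
by move=> /(lpnorm_le0_eq0 _ _ _ _ q1) /eqP; rewrite oppr_eq0 => /eqP.
Qed.

(** When the averaged gradient vanishes at [x], [mu] returns 0 and the projection fixes 0, so every
    iterate stays at 0. *)
Lemma apgd_stationary (R : realType) (p q : \bar R)
    (mu : forall D : nat, 'rV[R]_D -> 'rV[R]_D)
    (Pi : forall D : nat, R -> 'rV[R]_D -> 'rV[R]_D) (eta : R) (K : nat)
    (E : REC R) (x : 'rV[R]_(rec_dim E)) (y : label (rec_format E)) (eps : R) :
  (1 <= p)%E -> (1 <= q)%E -> is_steepest_ascent p mu ->
  is_ball_projection p q Pi -> 0 < eps ->
  \sum_i rec_prob i *: grad (fun z => cross_entropy (rec_clf i z) y) x = 0 ->
  apgd mu Pi eta K x y eps 0 = 0.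
Proof.
move=> p1 q1 hmu hPi e0 g0; elim: K => [//|K IH].
rewrite /apgd iterS -/(apgd mu Pi eta K x y eps 0) IH /apgd_step.
under eq_bigr do under eq_fun do rewrite addr0.
by rewrite g0 (hmu _).1 scaler0 addr0; apply: ball_projection0 hPi e0.
Qed.

(** Both sides are limits of the same difference quotient, since the coordinate of
    [h *: delta_mx 0 0] is [h]. *)
Lemma derive_coord (R : realType) (k : R -> R) :
  'D_(delta_mx 0 0) (fun z : 'rV[R]_1 => k (z 0 0)) 0 = 'D_1 k 0.
Proof.
apply: (congr1 (fun F : R -> R^o => lim (F @ 0^'))).
apply/funext => h /=.
by rewrite !mxE !addr0 !eqxx.
Qed.

Lemma derive_opp_arg (R : realType) (k : R -> R) :
  derivable k 0 1 -> 'D_1 (fun t => k (- t)) 0 = - 'D_1 k 0.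
Proof.
move=> dk.
(* The chain rule differentiates [k] at the image point [- 0]. *)
have dk' : is_derive (- (0 : R)) 1 k ('D_1 k 0) by rewrite oppr0; exact: derivableP.
have dN : is_derive (0 : R) 1 -%R (- 1) by exact: is_deriveNid.
by have [_] := is_derive1_comp dk' dN; rewrite mulrN1.
Qed.

Lemma derivable_comp_ln (R : realType) (f : R -> R) (x : R) :
  0 < f x -> derivable f x 1 -> derivable (fun s => ln (f s)) x 1.
Proof.
move=> fx df; by have [] := is_derive1_comp (is_derive1_ln fx) (derivableP df).
Qed.

Lemma derivable_cross_entropy (R : realType) (b : R) :
  derivable (fun s : R => @cross_entropy R Scalar (s + b) true) 0 1.
Proof.
have de : derivable (fun s : R => expR (s + b)) 0 1.
  have db : is_derive (0 : R) 1 (shift b) 1 by exact: is_derive_shift.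
  by have [] := is_derive1_comp (is_derive_expR (shift b 0)) db.
have d1e : derivable (fun s : R => 1 + expR (s + b)) 0 1.
  by apply: derivableD de; exact: derivable_cst.
have e0 : 0 < expR (0 + b) := expR_gt0 _.
have e1 : 0 < 1 + expR (0 + b) by rewrite addr_gt0.
have dV : derivable (fun s : R => (1 + expR (s + b))^-1) 0 1.
  by apply: derivableV d1e; rewrite gt_eqF.
have dl : derivable (fun s : R => ln (expR (s + b) / (1 + expR (s + b)))) 0 1.
  by apply: derivable_comp_ln; [rewrite divr_gt0|exact: derivableM de dV].
have dr : derivable (fun s : R => ln (1 / (1 + expR (s + b)))) 0 1.
  apply: derivable_comp_ln; first by rewrite divr_gt0.
  by apply: derivableM dV; exact: derivable_cst.
have dc (c : R) : derivable (fun=> c : R) (0 : R) 1 by exact: derivable_cst.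
(* The constants are the loss coefficients once [ysign] is evaluated to 1 at label [true]. *)
exact: derivableB (derivableM (dc (- ((1 + 1) / 2))) dl)
  (derivableM (dc ((1 - 1) / 2)) dr).
Qed.

(** The cancellation is a fact about reflection: [k (- t)] has at 0 the opposite derivative of [k].
    It is used with [k] the loss of the score [s + 1]. *)
Lemma sum_grad_mirror (R : realType) (k : R -> R) : derivable k 0 1 ->
  \sum_(i < 2) 2^-1 *: grad (fun z : 'rV[R]_1 => k ((-1) ^+ i * z 0 0)) 0 = 0.
Proof.
move=> dk; rewrite !big_ord_recl big_ord0 addr0 -scalerDr.
rewrite [X in _ *: X](_ : _ = 0) ?scaler0//.
apply/rowP => j; rewrite !mxE ord1.
under eq_fun do rewrite expr0 mul1r.
under [X in _ + 'D_ _ X _]eq_fun do rewrite expr1 mulN1r.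
by rewrite derive_coord (derive_coord _ (fun s => k (- s))) derive_opp_arg// subrr.
Qed.

(** The power of -1 puts both classifiers in one formula, with the argument shaped as in
    [sum_grad_mirror] and the bias added last. *)
Definition opposite_clf (R : realType) (i : 'I_2) (z : 'rV[R]_1) :
  score R Scalar := ((-1) ^+ i * z 0 0 + 1 : R).

Lemma differentiable_opposite_clf (R : realType) (i : 'I_2) (x : 'rV[R]_1) :
  differentiable (opposite_clf R i) x.
Proof.
apply: differentiableD; last exact: differentiable_cst.
apply: differentiableM; first exact: differentiable_cst.
exact: differentiable_coord.
Qed.

Lemma half_gt0 (R : realType) (i : 'I_2) : 0 < 2^-1 :> R.
Proof. by rewrite invr_gt0. Qed.

Lemma sum_half (R : realType) : \sum_(i < 2) 2^-1 = 1 :> R.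
Proof. by rewrite !big_ord_recl big_ord0 addr0 [RHS]splitr mul1r. Qed.

Definition opposite_REC (R : realType) : REC R :=
  MkREC (differentiable_opposite_clf R) (half_gt0 R) (sum_half R).

Lemma opposite_REC_accuracy0 (R : realType) :
  @accuracy R (opposite_REC R) 0 true = 1.
Proof.
rewrite -(sum_half R) /accuracy /=; apply: eq_bigr => i _.
by rewrite /opposite_clf mxE mulr0 add0r ltr01 mulr1.
Qed.

Lemma opposite_REC_accuracy2 (R : realType) :
  @accuracy R (opposite_REC R) (const_mx 2) true < 1.
Proof.
rewrite /accuracy /= !big_ord_recl big_ord0 /opposite_clf !mxE.
(* The second classifier scores 1 - 2 < 0, so only the weight 1/2 of the first remains. *)
have -> : (0 < (-1) ^+ lift ord0 (@ord0 0) * 2 + 1 :> R) = false.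
  by rewrite expr1 mulN1r addrC subr_gt0 ltNge ler1n.
by rewrite expr0 mul1r addr_gt0// mulr1 mulr0 !addr0 invf_lt1 ?ltr1n.
Qed.

Theorem theorem4p2 (R : realType) (p q : \bar R)
    (hp : (1 <= p)%E) (hq : (1 <= q)%E)
    (mu : forall D : nat, 'rV[R]_D -> 'rV[R]_D)
    (hmu : is_steepest_ascent p mu)
    (Pi : forall D : nat, R -> 'rV[R]_D -> 'rV[R]_D)
    (hPi : is_ball_projection p q Pi)
    (eta : R) (heta : 0 < eta) (K : nat) (hK : (1 <= K)%N) :
  ~ consistent p (APGD p mu Pi eta K) /\
  exists (E : REC R) (x : 'rV[R]_(rec_dim E)) (y : label (rec_format E))
      (eps : R) (delta0 : 'rV[R]_(rec_dim E)),
    0 < eps /\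
    lpnorm p delta0 <= eps /\
    accuracy x y = 1 /\
    (exists delta : 'rV[R]_(rec_dim E),
       lpnorm p delta <= eps /\ accuracy (x + delta) y < accuracy x y) /\
    accuracy (x + apgd mu Pi eta K x y eps delta0) y >= accuracy x y.
Proof.
(* The explicit counterexample also refutes consistency, its output being one of the possible
   outputs of [APGD]. *)
match goal with |- ~ _ /\ ?P => suff ex : P end.
  split=> // cons.
  have [E [x [y [eps [d0 [e0 [hd0 [a1 [[d [hd ad]] nadv]]]]]]]]] := ex.
  have := cons E x y eps e0 a1 (ex_intro2 _ _ d hd ad) _ (ex_intro2 _ _ d0 hd0 erefl).
  by rewrite /adversarial ltNge nadv.
pose d : 'rV[R]_1 := const_mx 2.
(* This radius is positive and admits [d] for every [p] without evaluating its norm. *)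
pose eps := Num.max 1 (lpnorm p d).
have e0 : 0 < eps by rewrite lt_max ltr01.
exists (opposite_REC R), 0, true, eps, 0; split=> //; split.
  by rewrite lpnorm0 // ltW.
split; first exact: opposite_REC_accuracy0; split.
  exists d; rewrite le_max lexx orbT add0r opposite_REC_accuracy0; split=> //.
  exact: opposite_REC_accuracy2.
rewrite (@apgd_stationary R p q) ?addr0//.
(* The loss of classifier [i] is by conversion [k ((-1) ^+ i * z 0 0)], where [k s] is the loss of
   [s + 1] at label [true]. *)
exact: sum_grad_mirror (derivable_cross_entropy R 1).
Qed.
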